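(* Let $A$ be a finitely generated free group and let $T$ be its Cayley graph with respect to a free basis. Let $B$ be a group, $\varphi:A\to\mathrm{Aut}(B)$ a homomorphism, and suppose $G=B\rtimes_\varphi A$ is finitely generated. Let $\rho$ be the action of $G$ on $T$ induced by the projection $G\twoheadrightarrow A$ and the natural action of $A$ on $T$. Let $e\in\partial T$ be represented by the geodesic ray $\tau$. (i) If there is a finite set $S\subseteq B$ such that for each $k\in\mathbb{Z}_{\ge0}$, $S$ generates $B$ over $A_k(\tau)$, then $e\in\Sigma^1(\rho)$. (ii) If for each $k\in\mathbb{Z}_{\le0}$, $B$ is not finitely generated over $A_k(\tau)$, then $e\notin\Sigma^1(\rho)$.
   Context: **Conventions.** Multiplication in $G=B\rtimes_\varphi A$ is $(b_1,a_1)(b_2,a_2)=(b_1\varphi_{a_1}(b_2),a_1a_2)$, so $asa^{-1}=\varphi_a(s)$ for $a\in A$, $s\in B$. $T$ is a simplicial tree with edges of length 1 and vertex set $A$, and $A$ acts on it by left multiplication. A set $S\subseteq B$ generates $B$ over a subset $A'\subseteq A$ if $\{asa^{-1}\mid s\in S,\ a\in A'\}$ generates $B$; $B$ is finitely generated over $A'$ if some finite $S\subseteq B$ generates $B$ over $A'$. **Rays and horoballs.** Points of $\partial T$ are represented uniquely by geodesic rays $\tau:[0,\infty)\to T$ with $\tau(0)=1\in A$; $\tau(\infty)$ denotes the point represented by $\tau$. For real $t$, $HB_t(\tau)=\bigcup_{l\ge\max\{0,t\}}\overline{\mathrm{Ball}_{l-t}(T,\tau(l))}$ (nested union of closed metric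 balls of radius $l-t$ centred at $\tau(l)$). For $k\in\mathbb{Z}$, $A_k(\tau)\subseteq A$ is the vertex set of $HB_k(\tau)$; equivalently $A_k(\tau)=\bigcup_{l\ge\max\{0,k\},\,l\in\mathbb{Z}}\overline{\mathrm{Ball}_{l-k}(A,\tau(l))}$, with closed balls in the word metric of $A$. **$\Sigma^1(\rho)$.** For an isometric action $\rho$ of $G$ on a proper CAT(0) space $M$ (here $M=T$), choose a non-empty free contractible $G$-CW-complex $Y$ and a continuous $G$-map $h:Y\to M$. For a geodesic ray $\tau$ and $t\in\mathbb{R}$ let $Y_{(\tau,t)}$ be the largest subcomplex of $Y$ contained in $h^{-1}(HB_t(\tau))$. Then $h$ is controlled connected over $\tau(\infty)$ if for every cocompact $G$-subspace $L\subseteq Y$ there is a cocompact $G$-subspace $L'\supseteq L$ such that for all $t\in\mathbb{R}$ there exists $\lambda(t)\ge0$ with: $( * )$ any two points of $Y_{(\tau,t)}\cap L$ can be connected by a path in $Y_{(\tau,t-\lambda(t))}\cap L'$; and $( ** )$ any two points of $Y_{(\tau,t+\lambda(t))}\cap L$ can be connected by a path in $Y_{(\tau,t)}\cap L'$. By a theorem of Bieri and Geoghegan this does not depend on the choice of $Y$ and $h$, and $\Sigma^1(\rho)$ is the set of $e\in\partial M$ over which $\rho$ is controlled connected. *)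

(* Defs.v *)
From HB Require Import structures.
From mathcomp Require Import all_boot all_order all_algebra.
From mathcomp Require Import generic_quotient.
From mathcomp Require Import all_classical all_reals all_analysis.

Set Implicit Arguments.
Unset Strict Implicit.
Unset Printing Implicit Defensive.

Import Order.TTheory GRing.Theory Num.Theory.
Import numFieldNormedType.Exports.

Local Open Scope classical_set_scope.
Local Open Scope ring_scope.

(** * Groups *)

Definition is_subgroup (H : groupType) (K : set H) : Prop :=
  [/\ K 1%g, (forall u v, K u -> K v -> K (u * v)%g) &
      (forall u, K u -> K (u^-1)%g)].

Definition generates (H : groupType) (X : set H) : Prop :=
  smallest (@is_subgroup H) X = [set: H].

Definition finitely_generated (H : groupType) : Prop :=
  exists2 X : set H, finite_set X & generates X.

Definition free_basis (A : groupType) (n : nat) (x : 'I_n -> A) : Prop :=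
  forall (H : groupType) (f : 'I_n -> H),
    exists2 u : {multiplicative A -> H}, (forall i, u (x i) = f i) &
      forall v : {multiplicative A -> H}, (forall i, v (x i) = f i) -> v =1 u.

Definition is_action (G : groupType) (X : Type) (act : G -> X -> X) : Prop :=
  (forall p, act 1%g p = p) /\
  (forall g h p, act (g * h)%g p = act g (act h p)).

(* Homomorphisms from [A] to [Aut B]: each [phi a] is bijective, with inverse
   [phi a^-1]. *)
Record aut_hom (A B : groupType) := AutHom {
  aut_fun :> A -> {multiplicative B -> B};
  aut_funP : is_action (fun a b => aut_fun a b)
}.

Definition sdprod (A B : groupType) (phi : aut_hom A B) : Type := (B * A)%type.

Section Semidirect.
Variables (A B : groupType) (phi : aut_hom A B).
Local Notation G := (sdprod phi).

HB.instance Definition _ := Choice.on G.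

Definition sd_mul (p q : G) : G := ((p.1 * phi p.2 q.1)%g, (p.2 * q.2)%g).
Definition sd_one : G := (1%g, 1%g).
Definition sd_inv (p : G) : G := (phi (p.2^-1)%g (p.1^-1)%g, (p.2^-1)%g).

Let phi1 b : phi 1%g b = b. Proof. exact: (aut_funP phi).1. Qed.
Let phiM a a' b : phi (a * a')%g b = phi a (phi a' b).
Proof. exact: (aut_funP phi).2. Qed.
Let phi_one a : phi a 1%g = 1%g.
Proof.
by apply: (@mulgI _ (phi a 1%g)); rewrite -gmulfM !mulg1.
Qed.

Lemma sd_mulA : associative sd_mul.
Proof. by move=> p q r; rewrite /sd_mul /= gmulfM phiM !mulgA. Qed.

Lemma sd_mul1 : left_id sd_one sd_mul.
Proof. by case=> b a; rewrite /sd_mul /= phi1 !mul1g. Qed.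

Lemma sd_mul1r : right_id sd_one sd_mul.
Proof. by case=> b a; rewrite /sd_mul /= phi_one !mulg1. Qed.

Lemma sd_mulV : left_inverse sd_one sd_inv sd_mul.
Proof. by case=> b a; rewrite /sd_mul /= -gmulfM !mulVg phi_one. Qed.

Lemma sd_mulVr : right_inverse sd_one sd_inv sd_mul.
Proof. by case=> b a; rewrite /sd_mul /= -phiM !mulgV phi1 mulgV. Qed.

HB.instance Definition _ :=
  isGroup.Build G sd_mulA sd_mul1 sd_mul1r sd_mulV sd_mulVr.

Definition sd_inl (b : B) : G := (b, 1%g).
Definition sd_inr (a : A) : G := (1%g, a).

Lemma sd_conj (a : A) (s : B) :
  (sd_inr a * sd_inl s * (sd_inr a)^-1)%g = sd_inl (phi a s).
Proof.
congr pair; last by rewrite /= mulg1 mulgV.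
by rewrite /= invg1 !phi_one mulg1 mul1g.
Qed.

(* By [sd_conj], [phi a s] is the conjugate of [s] by [a] in [G]. *)
Definition generates_over (S : set B) (A' : set A) : Prop :=
  generates [set b | exists s, exists a, [/\ S s, A' a & b = phi a s]].

Definition finitely_generated_over (A' : set A) : Prop :=
  exists2 S : set B, finite_set S & generates_over S A'.

End Semidirect.

(** * The Cayley tree *)

Definition letter (A : groupType) (n : nat) (x : 'I_n -> A) (l : 'I_n * bool)
  : A := if l.2 then x l.1 else ((x l.1)^-1)%g.

Definition word_val (A : groupType) (n : nat) (x : 'I_n -> A)
  (w : seq ('I_n * bool)) : A := (\prod_(l <- w) letter x l)%g.

(* Points of the geometric realization of the Cayley graph: [Inside a i s] is
   the point at distance [s] from [a] on the edge from [a] to [a * x i]. *)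
Inductive tree_point (R : realType) (A : groupType) (n : nat) :=
| Vertex of A
| Inside (a : A) (i : 'I_n) (s : R) of 0 < s < 1.

Definition cayley_tree (R : realType) (A : groupType) (n : nat)
  (x : 'I_n -> A) : Type := tree_point R A n.

Section Tree.
Variables (R : realType) (A : groupType) (n : nat) (x : 'I_n -> A).
Local Notation T := (cayley_tree R x).

Definition vertex (a : A) : T := Vertex R n a.

(* [exit p a r]: [a] is a vertex of the closed cell of [p], and it can be
   reached from [p] by a segment of length [r] in that cell. *)
Inductive exit : T -> A -> R -> Prop :=
| ExitVertex a : exit (vertex a) a 0
| ExitLeft a i s hs : exit (@Inside R A n a i s hs) a s
| ExitRight a i s hs : exit (@Inside R A n a i s hs) (a * x i)%g (1 - s).

(* Lengths of the paths joining two points: either a segment inside an open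
   edge, or a segment to a vertex, an edge path spelled by a word, and a
   segment from a vertex. *)
Inductive route : T -> T -> R -> Prop :=
| RouteInside a i s hs t ht :
    route (@Inside R A n a i s hs) (@Inside R A n a i t ht) `|s - t|
| RouteVertices p a r q b r' w :
    exit p a r -> exit q b r' -> (a * word_val x w = b)%g ->
    route p q (r + (size w)%:R + r').

Definition tree_dist (p q : T) : R := inf [set r | route p q r].

HB.instance Definition _ := gen_eqMixin T.
HB.instance Definition _ := gen_choiceMixin T.

Definition tree_open (U : set T) : Prop :=
  forall p, U p -> exists2 e : R, 0 < e & [set q | tree_dist p q < e] `<=` U.

Lemma tree_openT : tree_open setT.
Proof. by move=> p _; exists 1. Qed.

Lemma tree_openI (U V : set T) :
  tree_open U -> tree_open V -> tree_open (U `&` V).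
Proof.
move=> oU oV p [/oU[e e0 eU] /oV[d d0 dV]].
exists (Num.min e d); first by rewrite lt_min e0.
by move=> q /=; rewrite lt_min => /andP[pe pd]; split; [exact: eU|exact: dV].
Qed.

Lemma tree_open_bigcup (I : Type) (f : I -> set T) :
  (forall i, tree_open (f i)) -> tree_open (\bigcup_i f i).
Proof.
move=> of_ p [i _ /of_[e e0 ef]].
by exists e => // q /ef fq; exists i.
Qed.

(* This is the metric topology, as [tree_dist] is a distance when [x] is a free
   basis. *)
HB.instance Definition _ :=
  isOpenTopological.Build T tree_openT tree_openI tree_open_bigcup.

Definition tree_act (g : A) (p : T) : T :=
  match p with
  | Vertex a => Vertex R n (g * a)%g
  | Inside a i s hs => Inside (g * a)%g i hs
  end.

(* Each point of the boundary is represented by exactly one such ray, so this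
   type is the boundary of the tree. *)
Record based_ray := BasedRay {
  ray_fun :> {nonneg R} -> T;
  ray_isometry : forall s t : {nonneg R},
    tree_dist (ray_fun s) (ray_fun t) = `|s%:num - t%:num|;
  ray_base : ray_fun 0%:nng = vertex 1%g
}.

Definition horoball (tau : based_ray) (t : R) : set T :=
  \bigcup_(l in [set l : {nonneg R} | t <= l%:num])
    [set p | tree_dist (tau l) p <= l%:num - t].

Definition horoball_vertices (tau : based_ray) (k : int) : set A :=
  [set a | horoball tau k%:~R (vertex a)].

End Tree.

(** * G-CW-complexes *)

Section Disks.
Variables (R : realType) (n : nat).
Definition disk : set 'rV[R]_n := [set v | \sum_i v 0 i ^+ 2 <= 1].
Definition open_disk : set 'rV[R]_n := [set v | \sum_i v 0 i ^+ 2 < 1].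
Definition sphere : set 'rV[R]_n := [set v | \sum_i v 0 i ^+ 2 = 1].
End Disks.
Arguments disk R n : clear implicits.
Arguments open_disk R n : clear implicits.
Arguments sphere R n : clear implicits.

(* A CW-complex with a left [G]-action, for a discrete group [G], given by its
   characteristic maps.  [G] acts on the set of [n]-cells and the characteristic
   maps are equivariant; in particular an element mapping a cell to itself fixes
   it pointwise, i.e. the [n]-cells are attached as a disjoint union of
   [G/H x D^n].  Only the values of [char_map c] on the disk matter. *)
Record gcw_complex (R : realType) (G : groupType) := GCWComplex {
  gcw_space :> topologicalType;
  gact : G -> gcw_space -> gcw_space;
  gcell : nat -> Type;
  gcell_act : forall n, G -> gcell n -> gcell n;
  char_map : forall n, gcell n -> 'rV[R]_n -> gcw_space;
  gcw_hausdorff : hausdorff_space gcw_space;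
  gact_action : is_action gact;
  gact_continuous : forall g, continuous (gact g);
  gcell_action : forall n, is_action (@gcell_act n);
  char_map_equivariant : forall n g (c : gcell n) v, disk R n v ->
    char_map (gcell_act g c) v = gact g (char_map c v);
  char_map_continuous : forall n (c : gcell n),
    {within disk R n, continuous (char_map c)};
  char_map_inj : forall n (c : gcell n) u v, open_disk R n u ->
    open_disk R n v -> char_map c u = char_map c v -> u = v;
  char_map_open : forall n (c : gcell n) (U : set 'rV[R]_n), open U ->
    exists2 V : set gcw_space, open V &
      char_map c @` (U `&` open_disk R n) = V `&` char_map c @` open_disk R n;
  gcell_cover : forall y, exists n, exists c : gcell n,
    (char_map c @` open_disk R n) y;
  gcell_disjoint : forall n (c : gcell n) m (d : gcell m),
    (char_map c @` open_disk R n) `&` (char_map d @` open_disk R m) !=set0 ->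
    existT gcell n c = existT gcell m d;
  closure_finite : forall n (c : gcell n),
    exists2 F : set {m : nat & gcell m}, finite_set F &
      (forall d, F d -> (projT1 d < n)%N) /\
      char_map c @` sphere R n `<=`
        \bigcup_(d in F) (char_map (projT2 d) @` open_disk R (projT1 d));
  weak_topology : forall W : set gcw_space,
    (forall n (c : gcell n), closed (W `&` char_map c @` disk R n)) -> closed W
}.

Section GCWTheory.
Variables (R : realType) (G : groupType) (Y : gcw_complex R G).

Definition open_cell (c : {m : nat & gcell Y m}) : set Y :=
  char_map (projT2 c) @` open_disk R (projT1 c).
Definition closed_cell (c : {m : nat & gcell Y m}) : set Y :=
  char_map (projT2 c) @` disk R (projT1 c).

Definition free_action : Prop := forall g (y : Y), gact g y = y -> g = 1%g.

Definition contractible : Prop :=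
  exists y0 : Y, exists2 F : Y * R -> Y,
    {within [set: Y] `*` `[0, 1], continuous F} &
    forall y, F (y, 0) = y /\ F (y, 1) = y0.

Definition subcomplex (W : set Y) : Prop :=
  exists2 C : set {m : nat & gcell Y m},
    W = \bigcup_(c in C) open_cell c & forall c, C c -> closed_cell c `<=` W.

(* A union of subcomplexes is a subcomplex, so this is the largest subcomplex
   contained in [X]. *)
Definition largest_subcomplex (X : set Y) : set Y :=
  \bigcup_(W in [set W | subcomplex W /\ W `<=` X]) W.

Definition same_orbit (y z : Y) : bool := `[< exists g, gact g y = z >].

Lemma same_orbit_refl : reflexive same_orbit.
Proof. by move=> y; apply/asboolP; exists 1%g; apply: (gact_action Y).1. Qed.

Lemma same_orbit_sym : symmetric same_orbit.
Proof.
suff H y z : same_orbit y z -> same_orbit z y by move=> y z; apply/idP/idP; exact: H.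
move=> /asboolP[g <-]; apply/asboolP; exists (g^-1)%g.
by rewrite -(gact_action Y).2 mulVg (gact_action Y).1.
Qed.

Lemma same_orbit_trans : transitive same_orbit.
Proof.
move=> z y w /asboolP[g <-] /asboolP[h <-]; apply/asboolP; exists (h * g)%g.
exact: (gact_action Y).2.
Qed.

Canonical same_orbit_equiv :=
  EquivRel same_orbit same_orbit_refl same_orbit_sym same_orbit_trans.

Definition orbit_space : Type :=
  quotient_topology {eq_quot same_orbit_equiv}%qT.
HB.instance Definition _ := Topological.on orbit_space.
HB.instance Definition _ := Quotient.on orbit_space.

Definition orbit_map (y : Y) : orbit_space := (\pi_(orbit_space) y)%qT.

(* The orbit map is open, so the image of an invariant [L] carries the quotient
   topology of [L] modulo [G]. *)
Definition cocompact_subspace (L : set Y) : Prop :=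
  (forall g y, L y -> L (gact g y)) /\ compact (orbit_map @` L).

Definition joined_in (X : set Y) (y z : Y) : Prop :=
  exists gamma : R -> Y,
    [/\ {within `[0, 1], continuous gamma}, gamma 0 = y, gamma 1 = z &
        gamma @` `[0, 1] `<=` X].

End GCWTheory.

(** * The invariant *)

Section Sigma.
Variables (R : realType) (A B : groupType) (n : nat) (x : 'I_n -> A).
Variable phi : aut_hom A B.
Local Notation G := (sdprod phi).
Local Notation T := (cayley_tree R x).

(* The action of [G] on the tree through the projection to [A]. *)
Definition rho (g : G) (p : T) : T := tree_act g.2 p.

Variables (Y : gcw_complex R G) (h : Y -> T).

Definition control_map : Prop :=
  continuous h /\ forall g y, h (gact g y) = rho g (h y).

Definition Y_part (tau : based_ray R x) (t : R) : set Y :=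
  largest_subcomplex (h @^-1` horoball tau t).

Definition controlled_connected (tau : based_ray R x) : Prop :=
  forall L : set Y, cocompact_subspace L ->
  exists L' : set Y, [/\ cocompact_subspace L', L `<=` L' &
    forall t : R, exists lam : R, [/\ 0 <= lam,
      (forall y z, (Y_part tau t `&` L) y -> (Y_part tau t `&` L) z ->
         joined_in (Y_part tau (t - lam) `&` L') y z) &
      (forall y z, (Y_part tau (t + lam) `&` L) y ->
         (Y_part tau (t + lam) `&` L) z ->
         joined_in (Y_part tau t `&` L') y z)]].

(* [Sigma^1(rho)], computed with the given [Y] and [h]: by a theorem of Bieri and
   Geoghegan it is the same for every non-empty free contractible [Y] and every
   control map [h]. *)
Definition Sigma1 : set (based_ray R x) :=
  [set tau | controlled_connected tau].

End Sigma.

(* Main.v *)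
Require Import Defs.
From HB Require Import structures.
From mathcomp Require Import all_boot all_order all_algebra.
From mathcomp Require Import generic_quotient.
From mathcomp Require Import all_classical all_reals all_analysis.
From mathcomp Require Import ring lra.

Set Implicit Arguments.
Unset Strict Implicit.
Unset Printing Implicit Defensive.

Import Order.TTheory GRing.Theory Num.Theory.
Import numFieldNormedType.Exports.

Local Open Scope classical_set_scope.
Local Open Scope ring_scope.

(** The group [G] acts on [Y] through cells, and the two halves are read off
directly from any free contractible [Y] and any control map [h].

Every set cocompact modulo [G] lies in the translates of one finite subcomplex
[K] ([cocompact_finite]).  As [h K] is compact it lies within some distance [D]
of the vertex [1], so by equivariance [h (g K)] lies within [D] of the vertex
[g.2].  Up to bounded shifts of the horoball, a path in the part of [G K] over a
horoball is therefore a chain of overlapping translates [g K] whose coordinates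
[g.2] stay in that horoball, and the question becomes one about words in [G].

If [S] generates [B] over each [A_k], take [K] large enough to contain paths
from a base point [y0] to [s y0] for [s] in [S] and to [x_i y0] for each basis
element.  Right multiplication by the [x_i] moves [(b, a)] to [(b, a')] inside a
horoball, which is connected up to a bounded shift
([horoball_vertices_connected]).  Since [(b, a) s = (b * phi a s, a)], moving to
a suitable [a] of the horoball, multiplying by [s], and moving back multiplies
the [B]-coordinate by any [phi a s], hence by any element of [B]
([orbit_joined]).  The bound on the shift depends on [D] only, so one
lag serves all levels [t] and both halves of control
([controlled_connected_of_generates]).

Conversely suppose that [y0] and [b y0] are joined by a path over a horoball and
inside [G K], for each [b].  By freeness only finitely many [g] have [g K]
meeting [K]; let [S] be the set of their [B]-coordinates.  When [g K] and [g' K]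
meet at a point of the path, [g'.1 = g.1 * phi g.2 s] with [s] in [S] and [g.2]
in an enlarged horoball [A_k].  Hence the translates with [g.1] in the subgroup
generated by these [phi a s] and the other translates cut the path into two
disjoint closed pieces, and connectedness of the path leaves only the first:
[B] is generated by [S] over [A_k]
([generated_over_of_controlled_connected]). *)

(** * Words in a free basis *)

Section SubgroupType.
Variables (A : groupType) (K : {pred A}).
Hypothesis K_closed : group_closed K.

(** The closure proof is an argument so that the group structure can be inferred
from the type. *)
Definition subgroup_type (_ : group_closed K) : Type := {a : A | a \in K}.
Local Notation H := (subgroup_type K_closed).
HB.instance Definition _ := [isSub of H for sval].
HB.instance Definition _ := [Choice of H by <:].
HB.instance Definition _ := SubChoice_isSubGroup.Build A K H K_closed.
End SubgroupType.

Section Words.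
Variables (A : groupType) (n : nat) (x : 'I_n -> A).

Lemma word_val_cat w w' :
  word_val x (w ++ w') = (word_val x w * word_val x w')%g.
Proof. exact: big_cat. Qed.

Lemma word_val1 l : word_val x [:: l] = letter x l.
Proof. by rewrite /word_val big_seq1. Qed.

Definition word_inv (w : seq ('I_n * bool)) : seq ('I_n * bool) :=
  rev [seq (l.1, ~~ l.2) | l <- w].

Lemma word_val_inv w : word_val x (word_inv w) = ((word_val x w)^-1)%g.
Proof.
rewrite /word_inv; elim: w => [|l w IHw].
  by rewrite /word_val /= !big_nil invg1.
rewrite /= rev_cons -cats1 word_val_cat IHw -[in RHS]cat1s word_val_cat invgM.
by congr (_ * _)%g; rewrite !word_val1 /letter /=; case: l.2; rewrite //= invgK.
Qed.

Lemma size_word_inv w : size (word_inv w) = size w.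
Proof. by rewrite size_rev size_map. Qed.

(** The elements spelled by words form a subgroup [H]; sending each basis
element to itself in [H] and then including [H] in [A] gives an endomorphism
of [A] that fixes the basis, which can only be the identity. *)
Lemma free_basis_word_val :
  free_basis x -> forall a, exists w, word_val x w = a.
Proof.
move=> bas.
pose K : {pred A} := fun a => `[< exists w, word_val x w = a >].
have Kc : group_closed K.
  split=> [|u v /asboolP[w <-] /asboolP[w' <-]].
    by apply/asboolP; exists [::]; rewrite /word_val big_nil.
  by apply/asboolP; exists (w ++ word_inv w'); rewrite word_val_cat word_val_inv.
have Kx i : x i \in K by apply/asboolP; exists [:: (i, true)]; rewrite word_val1.
pose H := subgroup_type Kc.
have [u ux _] := bas H (fun i => exist _ (x i) (Kx i)).
have [v _ v_unique] := bas A x.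
pose j : {multiplicative H -> A} := (val : H -> A).
have ju : j \o u =1 v by apply: v_unique => i /=; rewrite ux.
have idv : idfun =1 v by apply: v_unique.
move=> a; have /asboolP := valP (u a).
by rewrite (_ : val (u a) = a) //; exact: etrans (ju a) (esym (idv a)).
Qed.
End Words.

(** * The distance of the Cayley tree *)

Section Distance.
Variables (R : realType) (A : groupType) (n : nat) (x : 'I_n -> A).
Local Notation T := (cayley_tree R x).
Local Notation vertex := (vertex R x).
Implicit Types (p q z : T) (a b c : A) (r : R).

Lemma exit_vertexE a c r : exit (vertex a) c r -> c = a /\ r = 0.
Proof.
move E: (vertex a) => p H; case: H E => // b.
by case=> ->.
Qed.

Lemma exit_insideE a i (s : R) (hs : 0 < s < 1) c r :
  exit (Inside a i hs : T) c r -> (c = a /\ r = s) \/ (c = a * x i /\ r = 1 - s)%g.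
Proof.
move E: (Inside a i hs : T) => p H; case: H E => // b j t ht [-> -> ->];
  by [left|right].
Qed.

Lemma exit_ge0 p a r : exit p a r -> 0 <= r.
Proof. by case=> // {}a i s /andP[s0 s1]; rewrite ?subr_ge0 ltW. Qed.

Lemma route_ge0 p q r : route p q r -> 0 <= r.
Proof.
case=> [*|{}p a {}r {}q b r' w /exit_ge0 ? /exit_ge0 ? _]; first exact: normr_ge0.
by rewrite !addr_ge0.
Qed.

Lemma tree_dist_le p q r : route p q r -> tree_dist p q <= r.
Proof.
by move=> H; apply: ge_inf => //; exists 0 => s /route_ge0.
Qed.

Lemma tree_dist_ge0 p q : 0 <= tree_dist p q.
Proof.
have [[r pr]|no] := pselect (exists r, route p q r).
  by apply: lb_le_inf; [exists r|move=> s /route_ge0].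
rewrite /tree_dist (_ : [set r | _] = set0) ?inf0 //.
by apply/seteqP; split=> // r pr; apply: no; exists r.
Qed.

Lemma exit_exists p : exists a, exists2 r, exit p a r & r <= 1.
Proof.
case: p => [a|a i s hs]; exists a; first by exists 0; [exact: ExitVertex|].
by exists s; [exact: ExitLeft|case/andP: hs => _ /ltW].
Qed.

(** If [b] and [c] are different ends of the edge of [q], then [r + r' = 1], which
is the length of the edge from [b] to [c]. *)
Lemma exit_exit q b r c r' : exit q b r -> exit q c r' ->
  exists2 w, (b * word_val x w = c)%g & (size w)%:R <= r + r'.
Proof.
case: q => [a|a i s hs].
  move=> /exit_vertexE[-> ->] /exit_vertexE[-> ->]; exists [::].
    by rewrite /word_val big_nil mulg1.
  by rewrite addr0.
have /andP[s0 s1] := hs.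
move=> /exit_insideE[][-> ->] /exit_insideE[][-> ->].
- by exists [::]; rewrite ?/word_val ?big_nil ?mulg1 //=; lra.
- by exists [:: (i, true)]; rewrite ?word_val1 //=; lra.
- by exists [:: (i, false)]; rewrite ?word_val1 /letter /= ?mulgK //=; lra.
- by exists [::]; rewrite ?/word_val ?big_nil ?mulg1 //=; lra.
Qed.

(** Moving along an open edge changes the distance to either end by at most the
length of the move. *)
Lemma exit_slide a i (s t : R) (hs : 0 < s < 1) (ht : 0 < t < 1) c r :
  exit (Inside a i ht : T) c r ->
  exists2 r', exit (Inside a i hs : T) c r' & r' <= `|s - t| + r.
Proof.
move=> /exit_insideE[][-> ->]; [exists s|exists (1 - s)];
  by [exact: ExitLeft|exact: ExitRight|have := ler_norm (s - t); lra
     |have := ler_norm (t - s); rewrite distrC; lra].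
Qed.

Lemma route_sym p q r : route p q r -> route q p r.
Proof.
case=> [a i s hs t ht|{}p a {}r {}q b r' w pa qb abw].
  by rewrite distrC; exact: RouteInside.
rewrite (_ : r + _ + _ = r' + (size (word_inv w))%:R + r); last first.
  by rewrite size_word_inv addrC addrA addrAC.
by apply: RouteVertices qb pa _; rewrite word_val_inv -abw mulgK.
Qed.

(** Two routes are concatenated at [q]; when [q] is inside an edge the detour
to its ends is replaced by what remains of that edge. *)
Lemma route_trans p q z r r' : route p q r -> route q z r' ->
  exists2 r'', route p z r'' & r'' <= r + r'.
Proof.
case=> [a i s hs t ht|{}p a {}r {}q b r1 w pa qb abw].
  move E: (Inside a i ht : T) => q0 H; case: H E.
    move=> _ _ t1 ht1 t2 ht2 [<- <- <-]; exists `|s - t2|; first exact: RouteInside.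
    exact: ler_distD.
  move=> q1 b r1 {}z c r2 w q1b zc bcw E; move: q1b; rewrite -E.
  move=> /(exit_slide hs)[r3 ab r3le].
  exists (r3 + (size w)%:R + r2); first exact: RouteVertices ab zc bcw.
  by rewrite addrA lerD2r addrA lerD2r.
move=> H; case: H qb.
  move=> {}a1 i s hs t ht ins.
  have [r3 tb r3le] := exit_slide ht ins.
  exists (r + (size w)%:R + r3); first exact: RouteVertices pa tb abw.
  by rewrite distrC in r3le; lra.
move=> {}q c r2 {}z d r3 w' qc zd cdw qb.
have [v bcv sv] := exit_exit qb qc.
exists (r + (size (w ++ v ++ w'))%:R + r3).
  apply: RouteVertices pa zd _.
  by rewrite !word_val_cat mulgA abw mulgA bcv.
by rewrite !size_cat !natrD; lra.
Qed.

Lemma tree_dist_refl p : tree_dist p p = 0.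
Proof.
apply/le_anti; rewrite tree_dist_ge0 andbT; case: p => [a|a i s hs].
  have := tree_dist_le (RouteVertices (w := [::]) (ExitVertex _ _ a)
    (ExitVertex _ _ a) _).
  by rewrite !addr0; apply; rewrite /word_val big_nil mulg1.
by have := tree_dist_le (RouteInside x a i hs hs); rewrite subrr normr0.
Qed.

Hypothesis x_gen : forall a, exists w, word_val x w = a.

Lemma route_exists p q : exists r, route p q r.
Proof.
have [a [r pa _]] := exit_exists p; have [b [r' qb _]] := exit_exists q.
have [w ww] := x_gen (a^-1 * b)%g; exists (r + (size w)%:R + r').
by apply: RouteVertices pa qb _; rewrite ww mulVKg.
Qed.

(** That the infimum is over a non-empty set is where generation of [A] by the
[x i], i.e. connectedness of the tree, is needed. *)
Lemma tree_dist_lt p q e : tree_dist p q < e -> exists2 r, route p q r & r < e.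
Proof.
by move=> pq; have [|r pr re] := inf_lt _ pq; [exact: route_exists|exists r].
Qed.

Lemma tree_dist_sym p q : tree_dist p q = tree_dist q p.
Proof.
by congr inf; apply/seteqP; split=> r; exact: route_sym.
Qed.

Lemma tree_dist_triangle q p z : tree_dist p z <= tree_dist p q + tree_dist q z.
Proof.
apply/ler_addgt0Pl => e e0; have e2 : 0 < e / 2 by rewrite divr_gt0.
have [r pq rle] : exists2 r, route p q r & r < tree_dist p q + e / 2.
  by apply: tree_dist_lt; rewrite ltrDl.
have [r' qz r'le] : exists2 r, route q z r & r < tree_dist q z + e / 2.
  by apply: tree_dist_lt; rewrite ltrDl.
have [r'' pz r''le] := route_trans pq qz.
by apply: le_trans (tree_dist_le pz) _; lra.
Qed.

Lemma near_vertex p : exists a, tree_dist p (vertex a) <= 1.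
Proof.
have [a [r pa r1]] := exit_exists p; exists a; apply: le_trans r1.
apply: tree_dist_le; rewrite -[r]addr0 -[X in X + 0]addr0.
apply: (RouteVertices (w := [::]) pa (ExitVertex _ _ a)).
by rewrite /word_val big_nil mulg1.
Qed.

Lemma tree_dist_vertex a w :
  tree_dist (vertex a) (vertex (a * word_val x w)%g) <= (size w)%:R.
Proof.
apply: tree_dist_le; rewrite -[_%:R]add0r -[X in route _ _ X]addr0.
exact: RouteVertices (ExitVertex _ _ a) (ExitVertex _ _ _) _.
Qed.

Lemma tree_dist_vertex_lt a b e : tree_dist (vertex a) (vertex b) < e ->
  exists2 w, (a * word_val x w = b)%g & (size w)%:R < e.
Proof.
move=> /tree_dist_lt[r H re]; move: H re.
move Ep: (vertex a) => p; move Eq: (vertex b) => q H.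
case: H Ep Eq => // {}p c {}r1 {}q d r2 w + + cd Ep Eq.
rewrite -Ep -Eq => /exit_vertexE[<- ->] /exit_vertexE[<- ->].
by rewrite add0r addr0; exists w.
Qed.

Lemma exit_act g p a r : exit p a r -> exit (tree_act g p : T) (g * a)%g r.
Proof.
by case=> *; rewrite ?mulgA; constructor.
Qed.

Lemma route_act g p q r : route p q r -> route (tree_act g p : T) (tree_act g q) r.
Proof.
case=> [*|p0 a r0 q0 b r1 w pa qb abw]; first exact: RouteInside.
apply: (RouteVertices (exit_act g pa) (exit_act g qb)).
by rewrite -mulgA abw.
Qed.

Lemma tree_actK g p : tree_act g^-1%g (tree_act g p) = p.
Proof. by case: p => * /=; rewrite mulKg. Qed.

Lemma tree_dist_act g p q :
  tree_dist (tree_act g p : T) (tree_act g q) = tree_dist p q.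
Proof.
congr inf; apply/seteqP; split=> r /=; last exact: route_act.
by move=> /(route_act g^-1%g); rewrite !tree_actK.
Qed.

Lemma tree_dist_continuous p : continuous (tree_dist p : T -> R).
Proof.
move=> q; apply/(@cvgrPdist_lt _ _ _ (nbhs q) (nbhs_filter q)) => e e0.
exists [set z | tree_dist q z < e]; split => //=.
- move=> z /= qz; exists (e - tree_dist q z); first by rewrite subr_gt0.
  move=> y /= zy; apply: le_lt_trans (tree_dist_triangle z q y) _.
  by rewrite -ltrBrDl.
- by rewrite tree_dist_refl.
- move=> z /= qz; rewrite ltr_norml ltrBrDl ltrBlDl; apply/andP; split.
    have := tree_dist_triangle q p z; lra.
  have := tree_dist_triangle z p q; rewrite (tree_dist_sym z q); lra.
Qed.
End Distance.

(** * Horoballs *)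

Section Horoball.
Variables (R : realType) (A : groupType) (n : nat) (x : 'I_n -> A).
Hypothesis x_gen : forall a, exists w, word_val x w = a.
Variable tau : based_ray R x.
Local Notation T := (cayley_tree R x).
Local Notation vertex := (vertex R x).

Lemma horoball_near (p q : T) (t D : R) :
  tree_dist p q <= D -> horoball tau t p -> horoball tau (t - D) q.
Proof.
have D0 := tree_dist_ge0 p q.
move=> pqD [l /= tl lp]; exists l => /=; first by lra.
by apply: le_trans (tree_dist_triangle x_gen p _ _) _; lra.
Qed.

Lemma horoball_le (s t : R) : s <= t -> horoball tau t `<=` horoball tau s.
Proof.
by move=> st p [l /= tl lp]; exists l => /=; [exact: le_trans tl|lra].
Qed.

Lemma ball_horoball (p : T) (D : R) :
  tree_dist (vertex 1%g) p <= D -> horoball tau (- D) p.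
Proof.
have D0 := tree_dist_ge0 (vertex 1%g) p.
move=> pD; exists 0%:nng => /=; first by lra.
by rewrite ray_base sub0r opprK.
Qed.

(** Any two points of a horoball lie in one of the balls that make it up, since
these are nested; in that ball both are joined to a vertex near the centre. *)
Lemma horoball_vertices_connected (E : A -> A -> Prop) (t : R) :
  (forall a, horoball tau (t - 3) (vertex a) -> E a a) ->
  (forall a b, E a b -> E b a) ->
  (forall a b c, E a b -> E b c -> E a c) ->
  (forall a i, horoball tau (t - 3) (vertex a) -> E a (a * x i)%g) ->
  forall a b, horoball tau t (vertex a) -> horoball tau t (vertex b) -> E a b.
Proof.
move=> Erefl Esym Etrans Ex.
(* both points lie in the ball around the further one of the two centres *)
have ball2 a b : horoball tau t (vertex a) -> horoball tau t (vertex b) ->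
    exists l : {nonneg R}, [/\ t <= l%:num,
      tree_dist (tau l) (vertex a) <= l%:num - t &
      tree_dist (tau l) (vertex b) <= l%:num - t].
  have grow (l m : {nonneg R}) c : l%:num <= m%:num ->
      tree_dist (tau l) (vertex c) <= l%:num - t ->
      tree_dist (tau m) (vertex c) <= m%:num - t.
    move=> lm lc; apply: le_trans (tree_dist_triangle x_gen (tau l) _ _) _.
    by rewrite ray_isometry ger0_norm ?subr_ge0 //; lra.
  move=> [l /= tl la] [m /= tm mb].
  have [lm|ml] := leP l%:num m%:num; [exists m|exists l]; split => //.
    exact: grow lm la.
  by apply: grow mb; exact: ltW.
move=> a b Ha Hb; have [l [tl la lb]] := ball2 a b Ha Hb.
have [c lc] := near_vertex (tau l).
(* the shift by 3: as [c] is within 1 of the centre, words from [c] to [a] and [b]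
   can be shorter than [l - t + 2], which keeps their vertices within [l - t + 3]
   of the centre *)
have word_c r w : (size w)%:R <= r -> r <= l%:num - t + 2 ->
    E c (c * word_val x w)%g.
  move=> wr rl; elim/last_ind: w wr => [|w [i s] IHw] wr.
    rewrite /word_val big_nil mulg1; apply: Erefl.
    by exists l => /=; lra.
  have wr' : (size w)%:R <= r.
    by apply: le_trans wr; rewrite ler_nat size_rcons.
  have near_c v : (size v)%:R <= r -> horoball tau (t - 3) (vertex (c * word_val x v)%g).
    move=> vr; exists l => /=; first by lra.
    have := tree_dist_triangle x_gen (vertex c) (tau l) (vertex (c * word_val x v)%g).
    have := tree_dist_vertex R x c v; lra.
  apply: Etrans (IHw wr') _.
  have E1 : (c * word_val x (rcons w (i, s)) = c * word_val x w * letter x (i, s))%g.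
    by rewrite -cats1 word_val_cat word_val1 mulgA.
  move: (near_c _ wr) (near_c _ wr'); rewrite E1; case: s {wr E1 near_c} => /=.
    by move=> _; exact: Ex.
  by move=> /(Ex _ i) + _; rewrite /letter /= mulgVK => /Esym.
have Ec d : tree_dist (tau l) (vertex d) <= l%:num - t -> E c d.
  move=> ld; have := tree_dist_triangle x_gen (tau l) (vertex c) (vertex d).
  rewrite (tree_dist_sym (vertex c) (tau l)) => cd.
  have [|w <- /ltW wr] := @tree_dist_vertex_lt _ _ _ _ x_gen c d (l%:num - t + 2).
    by apply: le_lt_trans cd _; lra.
  exact: word_c wr _.
by apply: Etrans (Ec b lb); exact/Esym/Ec.
Qed.
End Horoball.

(** * General topology *)

Section Topology.

Lemma within_continuous_comp_within (X Z W : topologicalType) (A : set X)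
    (B : set Z) (f : X -> Z) (g : Z -> W) :
  {within A, continuous f} -> {within B, continuous g} -> f @` A `<=` B ->
  {within A, continuous g \o f}.
Proof.
move=> fc gc fAB; apply/continuous_closedP => V cV.
have /closed_subspaceP[V1 cV1 V1E] := (continuous_closedP _).1 gc _ cV.
have /closed_subspaceP[V2 cV2 V2E] := (continuous_closedP _).1 fc _ cV1.
apply/closed_subspaceP; exists V2 => //; rewrite V2E.
apply/seteqP; split=> t [/= Vt At]; split=> //=.
  have : (V1 `&` B) (f t) by split=> //; apply: fAB; exists t.
  by rewrite V1E => -[].
have : (V1 `&` B) (f t) by rewrite V1E; split=> //; apply: fAB; exists t.
by case.
Qed.

Lemma eq_within_continuous (X Z : topologicalType) (A : set X) (f g : X -> Z) :
  {in A, f =1 g} -> {within A, continuous f} -> {within A, continuous g}.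
Proof. exact: subspace_eq_continuous. Qed.

Lemma compact_bigcup (X : topologicalType) (I : choiceType) (D : set I)
    (F : I -> set X) :
  finite_set D -> (forall i, D i -> compact (F i)) ->
  compact (\bigcup_(i in D) F i).
Proof.
move=> fD cF.
rewrite (eq_bigcupr (G := fun i => if i \in D then F i else set0)).
  rewrite -bigsetU_fset_set //; apply: bigsetU_compact => i _.
  by case: ifPn => [/set_mem/cF//|_]; exact: compact0.
by move=> i Di; rewrite mem_set.
Qed.

(** The sets that contain all but finitely many points of [D] form a filter,
which is proper when [D] is infinite; but no [p] is a cluster point of it, as
the complement of [D `\ p] is a neighbourhood of [p]. *)
Lemma compact_discrete_finite (X : topologicalType) (K D : set X) :
  compact K -> D `<=` K -> (forall J, J `<=` D -> closed J) -> finite_set D.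
Proof.
move=> cK DK Dclosed; apply: contrapT => infD.
pose F := [set S : set X | finite_set (D `\` S)].
have FF : ProperFilter F.
  apply: Build_ProperFilter_ex.
    move=> S FS; apply: contrapT => S0; apply: infD.
    by apply: sub_finite_set FS => q Dq; split=> // Sq; apply: S0; exists q.
  split; first by rewrite /F /= setDT; exact: finite_set0.
    by move=> S1 S2 F1 F2; rewrite /F /= setDIr finite_setU.
  move=> S1 S2 S12 F1; apply: sub_finite_set F1 => q [Dq nq].
  by split=> // /S12.
have [|p [_ /(_ (D `\ p) (~` (D `\ p))) []]] := cK F FF.
- by rewrite /F /= (_ : D `\` K = set0) ?setD_eq0 //; exact: finite_set0.
- by rewrite /F /= setDD; apply: sub_finite_set (finite_set1 p) => q [].
- apply: open_nbhs_nbhs; split; last by case=> _; apply.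
  by apply: closed_openC; apply: Dclosed => q [].
- by move=> q [].
Qed.
End Topology.

(** * Cells of an equivariant CW-complex *)

Section Disk.
Variables (R : realType) (n : nat).

Lemma disk_compact : compact (disk R n).
Proof.
apply: bounded_closed_compact.
  exists 1; split => // M M1 v; rewrite /disk /= => v1.
  rewrite [leLHS]/Num.norm /= mx_normrE; apply: bigmax_le.
    exact: ltW (lt_trans ltr01 M1).
  case=> i j _ /=; rewrite ord1; apply: le_trans (ltW M1).
  rewrite -(@ler_pXn2r _ 2) ?nnegrE // expr1n real_normK ?num_real //.
  by apply: le_trans v1; rewrite (bigD1 j) //= lerDl sumr_ge0 // => *; exact: sqr_ge0.
have -> : disk R n =
    (fun v : 'rV[R]_n => \sum_i v 0 i ^+ 2) @^-1` [set t | t <= 1] by [].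
apply: preimage_closed; last exact: closed_le.
move=> v _; elim: (index_enum _) => [|i r IHr].
  rewrite (_ : (fun _ => _) = cst 0); first exact: cst_continuous.
  by apply/funext => w; rewrite big_nil.
rewrite (_ : (fun _ => _) = (fun w : 'rV[R]_n => w 0 i * w 0 i) \+
    (fun w : 'rV[R]_n => \sum_(j <- r) w 0 j ^+ 2)).
  by apply: continuousD IHr; apply: continuousM; exact: coord_continuous.
by apply/funext => w; rewrite big_cons.
Qed.

Lemma disk0 : open_disk R n 0.
Proof.
by rewrite /open_disk /= big1 // => i _; rewrite mxE expr0n.
Qed.

Lemma open_disk_disk : open_disk R n `<=` disk R n.
Proof. by move=> v /ltW. Qed.

Lemma disk_scale v (s : R) : open_disk R n v -> 0 <= s <= 1 -> open_disk R n (s *: v).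
Proof.
rewrite /open_disk /= => v1 /andP[s0 s1]; apply: le_lt_trans v1.
apply: ler_sum => i _; rewrite mxE exprMn ler_piMl ?sqr_ge0 //.
exact: exprn_ile1.
Qed.

Lemma diskE : disk R n = open_disk R n `|` sphere R n.
Proof.
apply/seteqP; split=> v; rewrite /disk /open_disk /sphere /=.
  by rewrite le_eqVlt => /orP[/eqP|]; [right|left].
by case=> [/ltW|->].
Qed.

End Disk.

Section Cells.
Variables (R : realType) (G : groupType) (Y : gcw_complex R G).

(** A copy of the index type of the cells that carries a choice structure, so
that points and cells can be chosen and finite unions taken over it. *)
Definition cell : Type := {m : nat & gcell Y m}.
HB.instance Definition _ := gen_eqMixin cell.
HB.instance Definition _ := gen_choiceMixin cell.
Implicit Types (c d : cell) (y z : Y) (g : G) (W K : set Y).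

Definition cell_act g c : cell := existT _ (projT1 c) (gcell_act g (projT2 c)).
Definition cell_center c : Y := char_map (projT2 c) 0.

Lemma gactM g g' y : gact (g * g')%g y = gact g (gact g' y).
Proof. exact: (gact_action Y).2. Qed.

Lemma gact1 y : gact 1%g y = y.
Proof. exact: (gact_action Y).1. Qed.

Lemma gactK g y : gact g^-1%g (gact g y) = y.
Proof. by rewrite -gactM mulVg gact1. Qed.

Lemma gactVK g y : gact g (gact g^-1%g y) = y.
Proof. by rewrite -gactM mulgV gact1. Qed.

Lemma open_cell_center c : open_cell c (cell_center c).
Proof. by exists 0 => //; exact: disk0. Qed.

Lemma open_closed_cell c : open_cell c `<=` closed_cell c.
Proof. by move=> y [v /open_disk_disk]; exists v. Qed.

Lemma center_act g c : cell_center (cell_act g c) = gact g (cell_center c).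
Proof. exact: char_map_equivariant (open_disk_disk (disk0 R _)). Qed.

Lemma open_cell_act g c y : open_cell c y -> open_cell (cell_act g c) (gact g y).
Proof.
move=> [v v1 <-]; exists v => //.
exact: char_map_equivariant (open_disk_disk v1).
Qed.

Lemma closed_cell_act g c y :
  closed_cell c y -> closed_cell (cell_act g c) (gact g y).
Proof. by move=> [v v1 <-]; exists v => //; exact: char_map_equivariant. Qed.

Lemma cell_actK g c : cell_act g^-1%g (cell_act g c) = c.
Proof.
case: c => m c; rewrite /cell_act /=; congr existT.
by rewrite -(gcell_action Y m).2 mulVg (gcell_action Y m).1.
Qed.

Lemma open_cell_inj c d y : open_cell c y -> open_cell d y -> c = d.
Proof.
by case: c d => m c [k d] cy dy; apply: gcell_disjoint; exists y.
Qed.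

Lemma cell_cover y : {c : cell | open_cell c y}.
Proof.
by apply: cid; have [m [c cy]] := gcell_cover y; exists (existT _ m c).
Qed.

Definition cell_of y : cell := sval (cell_cover y).

Lemma cell_ofP y : open_cell (cell_of y) y.
Proof. exact: (svalP (cell_cover y)). Qed.

Lemma cell_ofE c y : open_cell c y -> cell_of y = c.
Proof. exact: open_cell_inj (cell_ofP y). Qed.

Lemma cell_of_act g y : cell_of (gact g y) = cell_act g (cell_of y).
Proof. by apply: cell_ofE; apply: open_cell_act; exact: cell_ofP. Qed.

(** An element that maps a cell to itself fixes its characteristic map. *)
Lemma orbit_cell_inj g c y : open_cell c y -> open_cell c (gact g y) -> gact g y = y.
Proof.
move=> cy cgy; have gc := open_cell_inj (open_cell_act g cy) cgy.
case: cy => v v1 <-.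
(* the domain of the characteristic map depends on the dimension of the cell *)
have cast e : e = c -> forall E : projT1 c = projT1 e,
    char_map (projT2 e) (castmx (erefl, E) v) = char_map (projT2 c) v.
  by move=> -> E; rewrite castmx_id.
have := cast _ gc erefl; rewrite castmx_id; apply: etrans; apply: esym.
exact: char_map_equivariant (open_disk_disk v1).
Qed.

End Cells.

(** * Subcomplexes and finiteness *)

Section Subcomplexes.
Variables (R : realType) (G : groupType) (Y : gcw_complex R G).
Local Notation cell := (cell Y).
Local Notation orb := (@orbit_map _ _ Y).
Implicit Types (c d : cell) (y z : Y) (g : G) (W K : set Y).

(** The open cells being disjoint, the cells of a subcomplex can be recovered from
its points; in this form stability under unions and translations is immediate. *)
Lemma subcomplexP W : subcomplex W <->
  forall c y, open_cell c y -> W y -> closed_cell c `<=` W.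
Proof.
split=> [[C -> Cclosed] c y cy [d Cd dy]|Wclosed].
  by rewrite (open_cell_inj cy dy); exact: Cclosed.
exists [set c | open_cell c `<=` W].
  apply/seteqP; split=> [y Wy|y [c cW /cW]//].
  exists (cell_of y); last exact: cell_ofP.
  by move=> z /open_closed_cell; exact: Wclosed (cell_ofP y) Wy z.
by move=> c cW; exact: Wclosed (open_cell_center c) (cW _ (open_cell_center c)).
Qed.

Lemma subcomplex_bigcup (I : Type) (D : set I) (F : I -> set Y) :
  (forall i, D i -> subcomplex (F i)) -> subcomplex (\bigcup_(i in D) F i).
Proof.
move=> sF; apply/subcomplexP => c y cy [i Di Fy] z cz.
by exists i => //; apply: (subcomplexP _).1 (sF i Di) c y cy Fy z cz.
Qed.

Lemma subcomplex_act g W : subcomplex W -> subcomplex (gact g @` W).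
Proof.
move=> sW; apply/subcomplexP => c z0 cy [y Wy gy]; rewrite -gy in cy => z cz.
exists (gact g^-1%g z); last exact: gactVK.
have := (subcomplexP _).1 sW (cell_act g^-1%g c) y _ Wy; apply.
  by rewrite -[y](gactK g); exact: open_cell_act.
exact: closed_cell_act.
Qed.

Lemma largest_subcomplex_subcomplex K : subcomplex (largest_subcomplex K).
Proof. by apply: subcomplex_bigcup => W []. Qed.

Lemma sub_largest_subcomplex W K :
  subcomplex W -> W `<=` K -> W `<=` largest_subcomplex K.
Proof. by move=> sW WK y Wy; exists W. Qed.

Lemma largest_subcomplex_sub K : largest_subcomplex K `<=` K.
Proof. by move=> y [W [_ WK] /WK]. Qed.

Definition finitely_many_cells K : Prop :=
  exists2 F : set cell, finite_set F & K `<=` \bigcup_(c in F) open_cell c.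

Lemma closed_cell_finite c : finitely_many_cells (closed_cell c).
Proof.
case: c => m c; have [F Ffin [_ cF]] := closure_finite c.
exists (existT _ m c |` F); first by rewrite finite_setU; split => //; exact: finite_set1.
move=> y [v]; rewrite diskE => -[v1|v1] <-.
  by exists (existT _ m c); [left|exists v].
by have [|d Fd dy] := cF (char_map c v); [exists v|exists d; [right|]].
Qed.

Lemma finitely_many_cells_bigcup (I : Type) (D : set I) (F : I -> set Y) :
  finite_set D -> (forall i, D i -> finitely_many_cells (F i)) ->
  finitely_many_cells (\bigcup_(i in D) F i).
Proof.
move=> Dfin Ffin.
pose H i := match pselect (D i) with
  | left Di => s2val (cid2 (Ffin i Di)) | right _ => set0 end.
exists (\bigcup_(i in D) H i).
  apply: bigcup_finite => // i Di; rewrite /H; case: pselect => // Di'.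
  exact: (s2valP (cid2 (Ffin i Di'))).
move=> y [i Di Fy]; have : (\bigcup_(c in H i) open_cell c) y.
  rewrite /H; case: pselect => // Di'.
  exact: (s2valP' (cid2 (Ffin i Di'))).
by case=> c Hc cy; exists c => //; exists i.
Qed.

Lemma closed_cell_compact c : compact (closed_cell c).
Proof.
rewrite /closed_cell; apply: continuous_compact; last exact: disk_compact.
exact: char_map_continuous.
Qed.

Lemma closed_cell_closed c : closed (closed_cell c).
Proof.
apply: compact_closed; first exact: gcw_hausdorff.
exact: closed_cell_compact.
Qed.

(** A closed cell meets only finitely many open cells, so its trace on [W] is that
of a finite union of closed cells contained in [W]. *)
Lemma subcomplex_closed W : subcomplex W -> closed W.
Proof.
move=> /subcomplexP sW; apply: weak_topology => m c.
have [F Ffin cF] := closed_cell_finite (existT _ m c).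
have -> : W `&` char_map c @` disk R m = closed_cell (existT _ m c) `&`
    \bigcup_(d in F `&` [set d | closed_cell d `<=` W]) closed_cell d.
  apply/seteqP; split=> [y [Wy cy]|y [cy [d [_ dW] /dW]]//].
  split=> //; have [d Fd dy] := cF y cy.
  by exists d; [split=> //; exact: sW Wy|exact: open_closed_cell].
apply: closedI; first exact: closed_cell_closed.
apply: (@closed_bigcup _ cell).
  by apply: sub_finite_set Ffin => d [].
by move=> d _; exact: closed_cell_closed.
Qed.

(** The trace of [K] on a closed cell is finite.  As every subset of [K] has the
same property, this provides closed discrete sets to play against compactness. *)
Lemma closed_of_sparse K :
  (forall c y z, K y -> K z -> open_cell c y -> open_cell c z -> y = z) ->
  closed K.
Proof.
move=> Ksparse; apply: weak_topology => m c.
have closed_finite : forall S : set Y, finite_set S -> closed S.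
  by apply/accessible_finite_set_closed/hausdorff_accessible; exact: gcw_hausdorff.
apply: closed_finite.
have [F Ffin cF] := closed_cell_finite (existT _ m c).
apply: (sub_finite_set (B := \bigcup_(d in F) (K `&` open_cell d))).
  by move=> y [Ky /cF[d Fd dy]]; exists d.
apply: bigcup_finite => // d _.
have [->|/set0P[y [Ky dy]]] := eqVneq (K `&` open_cell d) set0.
  exact: finite_set0.
by apply: sub_finite_set (finite_set1 y) => z [Kz dz]; exact: Ksparse dz dy.
Qed.

Definition finite_subcomplex W := subcomplex W /\ finitely_many_cells W.

Lemma finite_subcomplex_bigcup (I : Type) (D : set I) (F : I -> set Y) :
  finite_set D -> (forall i, D i -> finite_subcomplex (F i)) ->
  finite_subcomplex (\bigcup_(i in D) F i).
Proof.
move=> Dfin sF; split; first by apply: subcomplex_bigcup => i /sF[].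
by apply: finitely_many_cells_bigcup => // i /sF[].
Qed.

Lemma finite_subcomplex_compact W : finite_subcomplex W -> compact W.
Proof.
move=> [sW [F Ffin WF]].
apply: (subclosed_compact (B := \bigcup_(c in F) closed_cell c)).
- exact: subcomplex_closed.
- by apply: compact_bigcup => // c _; exact: closed_cell_compact.
- by move=> y /WF[c Fc /open_closed_cell]; exists c.
Qed.

(** Induction on the dimension: the boundary of a cell lies in finitely many cells
of lower dimension. *)
Lemma cell_sub_finite_subcomplex c :
  exists2 W, finite_subcomplex W & closed_cell c `<=` W.
Proof.
have [m le_m] := ubnP (projT1 c); elim: m c le_m => // m IHm c le_m.
case: c le_m => k c /= /ltnSE le_m.
have [F Ffin [Fdim cF]] := closure_finite c.
have hull d : exists W, F d -> finite_subcomplex W /\ closed_cell d `<=` W.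
  have [Fd|nFd] := pselect (F d); last by exists set0.
  have [|W ? ?] := IHm d; first exact: leq_trans (Fdim d Fd) le_m.
  by exists W.
have {hull}[W FW] := choice hull.
have [sW [C Cfin WC]] := finite_subcomplex_bigcup Ffin (fun d Fd => (FW d Fd).1).
pose V := open_cell (existT _ k c) `|` \bigcup_(d in F) W d.
have cV : closed_cell (existT _ k c) `<=` V.
  move=> y [v]; rewrite diskE => -[v1|v1] <-; first by left; exists v.
  have [|d Fd dy] := cF (char_map c v); first by exists v.
  by right; exists d => //; apply: (FW d Fd).2; exact: open_closed_cell.
exists V => //; split.
  apply/subcomplexP => d y dy [cy|Wy]; first by rewrite (open_cell_inj dy cy).
  by move=> z dz; right; exact: ((subcomplexP _).1 sW d y dy Wy z dz).
exists (existT _ k c |` C); first by rewrite finite_setU; split=> //; exact: finite_set1.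
by move=> y [cy|/WC[d Cd dy]]; [exists (existT _ k c); [left|]|exists d; [right|]].
Qed.

Lemma finite_hull K : finitely_many_cells K ->
  exists2 W, finite_subcomplex W & K `<=` W.
Proof.
move=> [F Ffin KF].
have [W FW] := choice (fun c => let: ex_intro2 W fW cW := cell_sub_finite_subcomplex c
  in ex_intro _ W (conj fW cW)).
exists (\bigcup_(c in F) W c).
  by apply: finite_subcomplex_bigcup => // c _; exact: (FW c).1.
by move=> y /KF[c Fc /open_closed_cell cy]; exists c => //; exact: (FW c).2.
Qed.

(** One point is chosen in each open cell that meets [K]; every set of such
points is closed. *)
Lemma compact_finitely_many_cells K : compact K -> finitely_many_cells K.
Proof.
move=> cK; pose f c : Y := xget (cell_center c) (K `&` open_cell c).
have fP c y : K y -> open_cell c y -> K (f c) /\ open_cell c (f c).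
  by move=> Ky cy; apply: (@xgetPex _ _ (K `&` open_cell c)); exists y.
pose D := [set f (cell_of y) | y in K].
have Dfin : finite_set D.
  apply: compact_discrete_finite cK _ _.
    by move=> _ [y Ky <-]; exact: (fP _ y Ky (cell_ofP y)).1.
  move=> J JD; apply: closed_of_sparse => c _ _ /JD[y Ky <-] /JD[z Kz <-].
  have [_ +] := fP _ y Ky (cell_ofP y); have [_ +] := fP _ z Kz (cell_ofP z).
  by move=> zz yy cy cz; rewrite (open_cell_inj yy cy) (open_cell_inj zz cz).
exists (@cell_of _ _ Y @` D); first exact: finite_image.
move=> y Ky; exists (cell_of y); last exact: cell_ofP.
exists (f (cell_of y)); first by exists y.
by apply: cell_ofE; exact: (fP _ y Ky (cell_ofP y)).2.
Qed.

Definition translates W : set Y := [set y | exists g, W (gact g y)].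

Lemma orbit_mapP y z : orb y = orb z <-> exists g, gact g y = z.
Proof.
split=> [/eqmodP/asboolP//|gyz].
by apply/eqmodP/asboolP.
Qed.

Lemma orbit_map_continuous : continuous orb.
Proof. exact: pi_continuous. Qed.

Lemma cocompact_translates W : compact W -> cocompact_subspace (translates W).
Proof.
move=> cW; split=> [g y [g' Wy]|].
  by exists (g' * g^-1)%g; rewrite gactM gactK.
have -> : orb @` translates W = orb @` W.
  apply/seteqP; split=> _ [y Wy <-].
    case: Wy => g Wy; exists (gact g y) => //; apply/esym/orbit_mapP.
    by exists g.
  by exists y => //; exists 1%g; rewrite gact1.
apply: continuous_compact => //; apply: continuous_subspaceT.
exact: orbit_map_continuous.
Qed.

(** The orbit of a cell is recorded by the orbit of its centre.  One point of [L]
is chosen in each orbit of open cells that meets [L]; the union of the orbits of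
any set of such points has at most one point in each open cell. *)
Lemma cocompact_finite L : cocompact_subspace L ->
  exists2 W, finite_subcomplex W & L `<=` translates W.
Proof.
move=> [Linv cL].
pose k y := orb (cell_center (cell_of y)).
have kE y z : k y = k z <-> exists g, cell_act g (cell_of y) = cell_of z.
  rewrite /k orbit_mapP; split=> -[g gyz]; exists g; last by rewrite -center_act gyz.
  rewrite -(cell_ofE (open_cell_center (cell_act g _))) center_act gyz.
  by apply: cell_ofE; exact: open_cell_center.
have kact g y : k (gact g y) = k y.
  by apply/esym/kE; exists g; rewrite cell_of_act.
pose f o : Y := xget (repr o) (L `&` [set y | k y = o]).
have fP y : L y -> L (f (k y)) /\ k (f (k y)) = k y.
  by move=> Ly; apply: (@xgetPex _ _ (L `&` [set z | k z = k y])); exists y.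
pose D := [set orb (f (k y)) | y in L].
have Dfin : finite_set D.
  apply: compact_discrete_finite cL _ _.
    by move=> _ [y Ly <-]; exists (f (k y)) => //; exact: (fP y Ly).1.
  move=> J JD; rewrite -openC.
  suff : closed (orb @^-1` J) by rewrite -openC.
  apply: closed_of_sparse => c y z Jy Jz cy cz.
  have [y1 Ly1 fy] := JD _ Jy; have [z1 Lz1 fz] := JD _ Jz.
  have /orbit_mapP[g gy] := fy; have /orbit_mapP[g' gz] := fz.
  have yz1 : k y1 = k z1.
    rewrite -(fP y1 Ly1).2 -(fP z1 Lz1).2 -(kact g) -(kact g' (f (k z1))) gy gz.
    by rewrite /k (cell_ofE cy) (cell_ofE cz).
  have zE : z = gact (g' * g^-1)%g y by rewrite gactM -gy gactK yz1.
  by rewrite zE in cz; rewrite zE; apply/esym; exact: orbit_cell_inj cy cz.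
have Kfin : finitely_many_cells [set f (k y) | y in L].
  exists (@cell_of _ _ Y @` [set f (k y) | y in L]).
    apply: finite_image; apply: (sub_finite_set (B := (fun o => f (k (repr o))) @` D)).
      move=> _ [y Ly <-]; exists (orb (f (k y))); first by exists y.
      have /orbit_mapP[g <-] : orb (f (k y)) = orb (repr (orb (f (k y)))).
        by rewrite /orbit_map reprK.
      by rewrite kact (fP y Ly).2.
    exact: finite_image.
  by move=> y Ly; exists (cell_of y); [exists y|exact: cell_ofP].
have [W fW LW] := finite_hull Kfin; exists W => // y Ly.
have /kE[g gE] := esym (fP y Ly).2.
exists g; have /subcomplexP sW := fW.1.
apply: (sW (cell_of (f (k y))) (f (k y))); first exact: cell_ofP.
  by apply: LW; exists y.
apply: open_closed_cell; rewrite -gE; apply: open_cell_act; exact: cell_ofP.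
Qed.
End Subcomplexes.

(** * Paths *)

Section Paths.
Variables (R : realType) (G : groupType) (Y : gcw_complex R G).
Implicit Types (X : set Y) (y z : Y).

Lemma joined_in_refl X y : X y -> joined_in X y y.
Proof.
move=> Xy; exists (cst y); split => //; last by move=> _ [s _ <-].
by apply: continuous_subspaceT; exact: cst_continuous.
Qed.

Lemma joined_in_sub X X' y z : X `<=` X' -> joined_in X y z -> joined_in X' y z.
Proof.
by move=> XX' [p [pc p0 p1 pX]]; exists p; split => //; exact: subset_trans XX'.
Qed.

Lemma joined_in_sym X y z : joined_in X y z -> joined_in X z y.
Proof.
move=> [p [pc p0 p1 pX]]; exists (p \o (fun s => 1 - s)).
have flip (s : R) : `[0, 1]%classic s -> `[0, 1]%classic (1 - s :> R).
  by rewrite /= !in_itv /= subr_ge0 gerBl => /andP[-> ->].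
split=> /=; [|by rewrite subr0|by rewrite subrr|].
  apply: within_continuous_comp_within pc _; last by move=> _ [s /flip ? <-].
  apply: continuous_subspaceT => s; apply: continuousB; first exact: cst_continuous.
  exact: cvg_id.
by move=> _ [s /flip s01 <-]; apply: pX; exists (1 - s).
Qed.

Lemma joined_in_trans X y z w :
  joined_in X y z -> joined_in X z w -> joined_in X y w.
Proof.
move=> [p [pc p0 p1 pX]] [q [qc q0 q1 qX]].
pose r (s : R) : Y := if s <= 2^-1 then p (2 * s) else q (2 * s - 1).
have rq s : 2^-1 <= s -> r s = q (2 * s - 1).
  rewrite le_eqVlt /r => /orP[/eqP <-|]; last by rewrite ltNge => /negbTE ->.
  by rewrite lexx mulfV // subrr p1 q0.
have left_half (s : R) : `[0, 2^-1]%classic s -> `[0, 1]%classic (2 * s :> R).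
  by rewrite /= !in_itv /= => /andP[s0 s1]; apply/andP; split; lra.
have right_half (s : R) : `[2^-1, 1]%classic s -> `[0, 1]%classic (2 * s - 1 :> R).
  by rewrite /= !in_itv /= => /andP[s0 s1]; apply/andP; split; lra.
exists r; split.
- have -> : `[0, 1]%classic = `[0, 2^-1]%classic `|` `[2^-1, 1]%classic :> set R.
    apply/seteqP; split=> s; rewrite /= !in_itv /=.
      move=> /andP[s0 s1]; have [s2|/ltW s2] := leP s 2^-1; [left|right]; exact/andP.
    by case=> /andP[s0 s1]; apply/andP; split; lra.
  apply: withinU_continuous; [exact: itv_closed|exact: itv_closed| |].
    apply: (@eq_within_continuous _ _ _ (p \o (fun s => 2 * s))).
      move=> s /set_mem; rewrite /= in_itv /= => /andP[_ s2].
      by rewrite /r s2.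
    apply: within_continuous_comp_within pc _; last by move=> _ [s /left_half ? <-].
    by apply: continuous_subspaceT; exact: mulrl_continuous.
  apply: (@eq_within_continuous _ _ _ (q \o (fun s => 2 * s - 1))).
    move=> s /set_mem; rewrite /= in_itv /= => /andP[s2 _].
    by rewrite rq.
  apply: within_continuous_comp_within qc _; last by move=> _ [s /right_half ? <-].
  apply: continuous_subspaceT => s; apply: continuousB; last exact: cst_continuous.
  exact: mulrl_continuous.
- by rewrite /r mulr0 invr_ge0 ler0n.
- rewrite rq; last by lra.
  by rewrite (_ : 2 * 1 - 1 = 1) //; lra.
- move=> _ [s s01 <-]; rewrite /r; move: s01; rewrite /= in_itv /= => /andP[s0 s1].
  have [s2|/ltW s2] := leP s 2^-1.
    by apply: pX; exists (2 * s) => //; apply: left_half; rewrite /= in_itv /= s0.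
  by apply: qX; exists (2 * s - 1) => //; apply: right_half; rewrite /= in_itv /= s2.
Qed.

Lemma joined_in_act g X y z :
  joined_in X y z -> joined_in (gact g @` X) (gact g y) (gact g z).
Proof.
move=> [p [pc <- <- pX]]; exists (gact g \o p); split => //.
  apply: within_continuous_comp => //.
  by move=> y' _; exact: gact_continuous.
by move=> _ [s s01 <-]; exists (p s) => //; apply: pX; exists s.
Qed.

Lemma joined_in_cell (c : cell Y) y :
  open_cell c y -> joined_in (open_cell c) (cell_center c) y.
Proof.
move=> [v v1 <-]; exists (char_map (projT2 c) \o (fun s : R => s *: v)).
have scale_in (s : R) : `[0, 1]%classic s -> open_disk R _ (s *: v).
  by rewrite /= in_itv /= => s01; exact: disk_scale.
split; [|by rewrite /= scale0r|by rewrite /= scale1r|]; last first.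
  by move=> _ [s s01 <-] /=; exists (s *: v) => //; exact: scale_in.
apply: (within_continuous_comp_within (B := disk R _)).
- by apply: continuous_subspaceT; exact: scalel_continuous.
- exact: char_map_continuous.
- by move=> _ [s /scale_in s1 <-]; exact: open_disk_disk.
Qed.

Lemma joined_in_finite_subcomplex y z : joined_in setT y z ->
  exists2 W, finite_subcomplex W & joined_in W y z.
Proof.
move=> [p [pc p0 p1 _]].
have /compact_finitely_many_cells/finite_hull[W fW pW] : compact (p @` `[0, 1]).
  by apply: continuous_compact => //; exact: segment_compact.
by exists W => //; exists p.
Qed.

Lemma contractible_joined_in : contractible Y -> forall y z, joined_in setT y z.
Proof.
move=> [y0 [F Fc FE]].
suff to_y0 y : joined_in setT y y0.
  by move=> y z; apply: joined_in_trans (to_y0 y) _; exact: joined_in_sym.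
exists (F \o (fun s => (y, s))); split => //=; [|exact: (FE y).1|exact: (FE y).2].
apply: (within_continuous_comp_within _ Fc); last by move=> _ [s s01 <-].
apply: continuous_subspaceT => s.
by apply: (@cvg_pair _ _ _ _ (nbhs y) (nbhs s)); [exact: cvg_cst|exact: cvg_id].
Qed.
End Paths.

Section Finiteness.
Variables (R : realType) (G : groupType) (Y : gcw_complex R G).
Implicit Types (y z : Y) (K W : set Y).

Lemma finite_subcomplexU K W :
  finite_subcomplex K -> finite_subcomplex W -> finite_subcomplex (K `|` W).
Proof.
move=> fK fW; rewrite -bigcup2inE; apply: (finite_subcomplex_bigcup (D := `I_2)).
  exact: finite_II.
by move=> [|[|]].
Qed.

(** In a free complex an element is determined by what it does to one cell. *)
Lemma finite_meeting_translates K W : free_action Y ->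
  finitely_many_cells K -> finitely_many_cells W ->
  finite_set [set g | exists2 y, K y & W (gact g y)].
Proof.
move=> Yfree [F Ffin KF] [F' F'fin WF'].
pose f (p : cell Y * cell Y) : G := xget 1%g [set g | cell_act g p.1 = p.2].
apply: (sub_finite_set (B := f @` (F `*` F'))); last first.
  by apply: finite_image; exact: finite_setX.
move=> g [y /KF[c Fc cy] /WF'[d F'd dgy]]; exists (c, d) => //.
have gcd : cell_act g c = d := open_cell_inj (open_cell_act g cy) dgy.
have fcd : cell_act (f (c, d)) c = d.
  by apply: (@xgetPex _ _ [set g' | cell_act g' c = d]); exists g.
suff : (g^-1 * f (c, d))%g = 1%g by move/(congr1 (fun k => g * k)%g); rewrite mulVKg mulg1.
apply: (Yfree _ (cell_center c)).
by rewrite gactM -center_act fcd -gcd -center_act cell_actK.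
Qed.

Lemma finite_set_joined_in (P : set Y) y : finite_set P -> contractible Y ->
  exists2 W, finite_subcomplex W & forall z, P z -> joined_in W y z.
Proof.
move=> Pfin Yc.
have [W WP] := choice (fun z => let: ex_intro2 W fW yz :=
  joined_in_finite_subcomplex (contractible_joined_in Yc y z) in ex_intro _ W (conj fW yz)).
exists (\bigcup_(z in P) W z).
  by apply: finite_subcomplex_bigcup => // z _; exact: (WP z).1.
by move=> z Pz; apply: joined_in_sub (WP z).2 => w Ww; exists z.
Qed.

(** Each point of [W] is joined inside its cell to the centre of that cell, and
there are finitely many centres. *)
Lemma finite_subcomplex_joined_in W y : finite_subcomplex W -> contractible Y ->
  exists2 K, finite_subcomplex K & W `<=` K /\ forall z, W z -> joined_in K y z.
Proof.
move=> fW Yc; have [/subcomplexP sW [F Ffin WF]] := fW.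
have [K fK yK] := finite_set_joined_in y (finite_image (@cell_center _ _ Y) Ffin) Yc.
exists (K `|` W); first exact: finite_subcomplexU.
split=> [|z Wz]; first exact: subsetUr.
have [c Fc cz] := WF z Wz.
apply: (@joined_in_trans _ _ _ _ _ (cell_center c)).
  by apply: joined_in_sub (yK _ _); [exact: subsetUl|exists c].
apply: joined_in_sub (joined_in_cell cz) => w cw; right.
by apply: sW cz Wz _ _; exact: open_closed_cell.
Qed.
End Finiteness.

(** * Controlled connectedness *)

Section Coordinates.
Variables (A B : groupType) (phi : aut_hom A B).

Lemma sd_mul_inr b (a a' : A) :
  (((b, a) : sdprod phi) * sd_inr phi a')%g = (b, (a * a')%g).
Proof.
congr pair => /=; apply: (@mulgI _ b^-1%g); rewrite mulKg mulVg.
by apply: (@mulgI _ (phi a 1%g)); rewrite -gmulfM !mulg1.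
Qed.

Lemma sd_mul_inl b (a : A) s :
  (((b, a) : sdprod phi) * sd_inl phi s)%g = ((b * phi a s)%g, a).
Proof. by congr pair; exact: mulg1. Qed.
End Coordinates.

Section Control.
Variables (R : realType) (A B : groupType) (n : nat) (x : 'I_n -> A).
Variable phi : aut_hom A B.
Local Notation G := (sdprod phi).
Variables (Y : gcw_complex R G) (h : Y -> cayley_tree R x).
Hypothesis x_gen : forall a, exists w, word_val x w = a.
Hypothesis h_control : control_map h.
Variable tau : based_ray R x.
Local Notation vertex := (vertex R x).
Implicit Types (g : G) (y z : Y) (K W : set Y) (t D : R) (b s : B) (a : A).

Definition displaced_at_most K D : Prop :=
  forall y, K y -> tree_dist (vertex 1%g) (h y) <= D.

Lemma compact_displaced K : compact K -> exists D, displaced_at_most K D.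
Proof.
move=> cK; pose f := tree_dist (vertex 1%g) \o h.
have fc : continuous f.
  move=> y; apply: continuous_comp; first exact: h_control.1.
  exact: tree_dist_continuous.
have /compact_bounded[M [_ MK]] : compact (f @` K).
  by apply: continuous_compact cK; exact: continuous_subspaceT.
exists (`|M| + 1) => y Ky; apply: le_trans (ler_norm _) _.
apply: (MK (`|M| + 1)); last by exists y.
by rewrite (le_lt_trans (ler_norm M)) // ltrDl.
Qed.

(** The control map is equivariant and [G] acts on the tree by isometries. *)
Lemma displaced_translate K D g y : displaced_at_most K D -> K y ->
  tree_dist (vertex g.2) (h (gact g y)) <= D.
Proof.
move=> KD Ky; rewrite h_control.2 /rho.
have -> : vertex g.2 = tree_act g.2 (vertex 1%g) by rewrite /= mulg1.
by rewrite tree_dist_act; exact: KD.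
Qed.

Lemma translate_sub_Y_part K D t g : subcomplex K -> displaced_at_most K D ->
  horoball tau t (vertex g.2) -> gact g @` K `<=` Y_part h tau (t - D).
Proof.
move=> sK KD Hg; apply: sub_largest_subcomplex; first exact: subcomplex_act.
move=> _ [y Ky <-]; apply: horoball_near Hg => //.
exact: displaced_translate Ky.
Qed.

Lemma translate_vertex K D t g y : displaced_at_most K D -> K y ->
  horoball tau t (h (gact g y)) -> horoball tau (t - D) (vertex g.2).
Proof.
move=> KD Ky; apply: horoball_near => //.
by rewrite tree_dist_sym; exact: displaced_translate Ky.
Qed.

Lemma Y_part_le (t' t : R) : t' <= t -> Y_part h tau t `<=` Y_part h tau t'.
Proof.
move=> tt; apply: sub_largest_subcomplex.
  exact: largest_subcomplex_subcomplex.
by move=> y /largest_subcomplex_sub; exact: horoball_le.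
Qed.

(** In this section [W] holds the points to be joined and [K] the paths from [y0]
to them, so that one step of a word in [G] is a translate of a path in [K]. *)
Section Connected.
Variables (W K : set Y) (y0 : Y) (D : R) (S : set B).
Hypothesis K_fin : finite_subcomplex K.
Hypothesis K_displaced : displaced_at_most K D.
Hypothesis W_K : W `<=` K.
Hypothesis W_joined : forall y, W y -> joined_in K y0 y.
Hypothesis W_y0 : W y0.
Hypothesis W_S : forall s, S s -> W (gact (sd_inl phi s) y0).
Hypothesis W_x : forall i, W (gact (sd_inr phi (x i)) y0).
Hypothesis S_gen :
  forall k : int, 0 <= k -> generates_over phi S (horoball_vertices tau k).

Lemma translate_sub_part t g : horoball tau t (vertex g.2) ->
  gact g @` K `<=` Y_part h tau (t - D) `&` translates K.
Proof.
move=> Hg _ [z Kz <-]; split; last by exists g^-1%g; rewrite gactK.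
by apply: (translate_sub_Y_part K_fin.1 K_displaced Hg); exists z.
Qed.

Lemma translate_joined t g y : horoball tau t (vertex g.2) -> W y ->
  joined_in (Y_part h tau (t - D) `&` translates K) (gact g y0) (gact g y).
Proof.
move=> Hg Wy; apply: joined_in_sub (joined_in_act g (W_joined Wy)).
exact: translate_sub_part.
Qed.

(** The elements of [B] by which the first coordinate can be multiplied along a
path over the lower horoball form a subgroup, and it contains every [phi a s]
with [s] in [S] and [a] in the upper horoball. *)
Lemma orbit_joined t g g' :
  horoball tau t (vertex g.2) -> horoball tau t (vertex g'.2) ->
  joined_in (Y_part h tau (t - 3 - D) `&` translates K) (gact g y0) (gact g' y0).
Proof.
pose J (g1 g2 : G) := joined_in (Y_part h tau (t - 3 - D) `&` translates K)
  (gact g1 y0) (gact g2 y0).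
rewrite -/(J g g').
have Jsym g1 g2 : J g1 g2 -> J g2 g1 by exact: joined_in_sym.
have Jtrans g1 g2 g3 : J g1 g2 -> J g2 g3 -> J g1 g3 by exact: joined_in_trans.
have Jstep (g1 g2 : G) : horoball tau (t - 3) (vertex g1.2) -> W (gact g2 y0) ->
    J g1 (g1 * g2)%g.
  by move=> Hg1 Wg2; rewrite /J gactM; exact: translate_joined.
have t3 : t - 3 <= t by lra.
have Jrefl (g1 : G) : horoball tau (t - 3) (vertex g1.2) -> J g1 g1.
  move=> Hg1; apply: joined_in_refl; apply: (translate_sub_part Hg1).
  by exists y0 => //; exact: W_K.
have JA b a a' : horoball tau t (vertex a) -> horoball tau t (vertex a') ->
    J (b, a) (b, a').
  apply: (horoball_vertices_connected x_gen (E := fun a a' => J (b, a) (b, a'))).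
  - by move=> c; exact: (Jrefl (b, c)).
  - by move=> c d; exact: Jsym.
  - by move=> c d e; exact: Jtrans.
  move=> c i Hc; have := Jstep (b, c) (sd_inr phi (x i)) Hc (W_x i).
  by rewrite sd_mul_inr.
pose Q : set B := [set s | forall b a, horoball tau t (vertex a) ->
  J (b, a) ((b * s)%g, a)].
have Q_subgroup : is_subgroup Q.
  split=> [b a Ha|u v Qu Qv b a Ha|u Qu b a Ha].
  - by rewrite mulg1; apply: (Jrefl (b, a)); exact: horoball_le Ha.
  - by rewrite mulgA; apply: Jtrans (Qu b a Ha) (Qv _ a Ha).
  - by apply: Jsym; have := Qu (b * u^-1)%g a Ha; rewrite mulgVK.
(* [S_gen] is about non-negative integers only; a larger level gives a smaller
   horoball *)
pose k : int := Posz (Num.truncn `|t|).+1.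
have tk : t <= k%:~R.
  by apply: le_trans (ler_norm t) _; exact: ltW (truncnS_gt _).
have Q_gen : [set b | exists s, exists a,
    [/\ S s, horoball_vertices tau k a & b = phi a s]] `<=` Q.
  move=> _ [s [a [Ss Ha ->]]] b a' Ha'.
  have {}Ha : horoball tau t (vertex a) by exact: horoball_le Ha.
  apply: (Jtrans _ _ _ (JA b a' a Ha' Ha)).
  apply: (Jtrans _ _ _ _ (JA _ a a' Ha Ha')).
  have := Jstep (b, a) (sd_inl phi s) (horoball_le t3 Ha) (W_S Ss).
  by rewrite sd_mul_inl.
have QT b : Q b.
  have : [set: B] b by [].
  by rewrite -(S_gen (k := k) isT) => /(_ Q); apply.
case: g g' => b a [b' a'] Ha Ha'.
apply: (Jtrans _ _ _ (JA b a a' Ha Ha')).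
by have := QT (b^-1 * b')%g b a' Ha'; rewrite mulVKg.
Qed.

(** The constant adds up the shift by [D] from a point to the vertex of its
translate, the shift by 3 for connecting vertices, and the shift by [D] back. *)
Lemma Y_part_joined t y z : (Y_part h tau t `&` translates W) y ->
  (Y_part h tau t `&` translates W) z ->
  joined_in (Y_part h tau (t - (2 * D + 3)) `&` translates K) y z.
Proof.
have D0 : 0 <= D by apply: le_trans (K_displaced (W_K W_y0)); exact: tree_dist_ge0.
have to_orbit w : (Y_part h tau t `&` translates W) w -> exists2 g : G,
    horoball tau (t - D) (vertex g.2) &
    joined_in (Y_part h tau (t - (2 * D + 3)) `&` translates K) (gact g y0) w.
  move=> [/largest_subcomplex_sub Hw [g Wgw]].
  have Hg : horoball tau (t - D) (vertex (g^-1)%g.2).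
    by apply: (translate_vertex K_displaced (W_K Wgw)); rewrite gactK.
  exists g^-1%g => //; have := translate_joined Hg Wgw; rewrite gactK.
  by apply: joined_in_sub => v [Yv ?]; split=> //; apply: Y_part_le Yv; lra.
move=> /to_orbit[g Hg gy] /to_orbit[g' Hg' gz].
apply: joined_in_trans (joined_in_sym gy) _; apply: joined_in_trans gz.
have := orbit_joined Hg Hg'; rewrite (_ : t - D - 3 - D = t - (2 * D + 3)) //.
lra.
Qed.
End Connected.

Lemma controlled_connected_of_generates (S : set B) : [set: Y] !=set0 ->
  contractible Y -> finite_set S ->
  (forall k : int, 0 <= k -> generates_over phi S (horoball_vertices tau k)) ->
  controlled_connected h tau.
Proof.
move=> [y0 _] Yc Sfin Sgen L cL.
have [W fW LW] := cocompact_finite cL.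
pose P : set Y := y0 |` ([set gact (sd_inl phi s) y0 | s in S] `|`
  [set gact (sd_inr phi (x i)) y0 | i in [set: 'I_n]]).
have Pfin : finite_set P.
  by rewrite !finite_setU; split=> //; split; exact: finite_image.
have [V fV PV] : exists2 V : set Y, finite_subcomplex V & P `<=` V.
  apply: finite_hull; exists (@cell_of _ _ Y @` P); first exact: finite_image.
  by move=> y Py; exists (cell_of y); [exists y|exact: cell_ofP].
have [K fK [VWK K_joined]] :=
  finite_subcomplex_joined_in y0 (finite_subcomplexU fV fW) Yc.
have PVW z : P z -> (V `|` W) z by move=> Pz; left; exact: PV.
have [D KD] := compact_displaced (finite_subcomplex_compact fK).
have VW_y0 : (V `|` W) y0 by apply: PVW; left.
have D0 : 0 <= D by apply: le_trans (KD y0 (VWK _ VW_y0)); exact: tree_dist_ge0.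
have VW_S s : S s -> (V `|` W) (gact (sd_inl phi s) y0).
  by move=> Ss; apply: PVW; right; left; exists s.
have VW_x i : (V `|` W) (gact (sd_inr phi (x i)) y0).
  by apply: PVW; right; right; exists i.
have LVW : L `<=` translates (V `|` W) by move=> y /LW[g Wgy]; exists g; right.
exists (translates K); split.
- exact/cocompact_translates/finite_subcomplex_compact.
- by move=> y /LVW[g VWgy]; exists g; exact: VWK.
have joinedK t := Y_part_joined fK KD VWK K_joined VW_y0 VW_S VW_x Sgen (t := t).
move=> t; exists (2 * D + 3); split; first by lra.
  by move=> y z [Yy /LVW Ly] [Yz /LVW Lz]; exact: joinedK.
move=> y z [Yy /LVW Ly] [Yz /LVW Lz].
by have := joinedK _ y z (conj Yy Ly) (conj Yz Lz); rewrite addrK.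
Qed.

(** The level [- D0] is low enough for the whole [B]-orbit of [y0] to lie over it;
the path from [y0] to [b y0] is then cut by [W1] and [W2]. *)
Lemma generated_over_of_controlled_connected : [set: Y] !=set0 ->
  free_action Y -> controlled_connected h tau ->
  exists2 k : int, k <= 0 & finitely_generated_over phi (horoball_vertices tau k).
Proof.
move=> [y0 _] Yfree cc.
have [K0 fK0 K0y0] := cell_sub_finite_subcomplex (cell_of y0).
have {}K0y0 : K0 y0 by apply: K0y0; apply: open_closed_cell; exact: cell_ofP.
have [D0 K0D0] := compact_displaced (finite_subcomplex_compact fK0).
have [L' [cL' _ /(_ (0 - D0))[lam [lam0 + _]]]] :=
  cc _ (cocompact_translates (finite_subcomplex_compact fK0)).
set t := 0 - D0 - lam => joined.
have [W fW LW] := cocompact_finite cL'.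
have fK := finite_subcomplexU fK0 fW; set K := K0 `|` W in fK.
have [D KD] := compact_displaced (finite_subcomplex_compact fK).
pose k : int := - Posz (Num.truncn `|t - D|).+1.
have kt : k%:~R <= t - D.
  rewrite /k mulrNz lerNl; apply: le_trans (ltW (truncnS_gt _)).
  by rewrite -normrN; exact: ler_norm.
exists k; first by rewrite /k oppr_le0.
pose Sigma := [set g : G | exists2 y, K y & K (gact g y)].
have Sigma_fin : finite_set Sigma := finite_meeting_translates Yfree fK.2 fK.2.
exists [set g.1 | g in Sigma]; first exact: finite_image.
pose X := [set b | exists s, exists a, [/\ [set g.1 | g in Sigma] s,
  horoball_vertices tau k a & b = phi a s]].
pose H := smallest (@is_subgroup B) X.
have [H1 HM HV] : is_subgroup H.
  split=> [M [[M1 _ _] _] //|u v Hu Hv M MX|u Hu M MX].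
  - by have [[_ MM _] _] := MX; apply: MM; [exact: Hu|exact: Hv].
  - by have [[_ _ MV] _] := MX; apply: MV; exact: Hu.
have HX : X `<=` H by move=> b Xb M [_]; apply.
rewrite /generates_over /generates -/X -/H; apply/seteqP; split=> // b _.
have meet g g' y y' : K y -> K y' -> gact g y = gact g' y' ->
    horoball tau t (h (gact g y)) -> H g.1 -> H g'.1.
  move=> Ky Ky' gyE /(translate_vertex KD Ky) Hg gH.
  rewrite -[g'](mulVKg g); apply: HM => //; apply: HX.
  exists (g^-1 * g')%g.1, g.2; split=> //; last exact: horoball_le Hg.
  by exists (g^-1 * g')%g => //; exists y' => //; rewrite gactM -gyE gactK.
have Yt g : g.2 = 1%g -> (Y_part h tau (0 - D0) `&` translates K0) (gact g y0).
  move=> g1; split; last by exists g^-1%g; rewrite gactK.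
  apply: (translate_sub_Y_part fK0.1 K0D0); last by exists y0.
  by rewrite g1 -[0]oppr0; apply: ball_horoball; rewrite tree_dist_refl.
have [p [pc p0 p1 pY]] := joined _ _ (Yt 1%g erefl) (Yt (sd_inl phi b) erefl).
have K_y0 : K y0 by left.
pose W1 := \bigcup_(g in [set g : G | H g.1]) (gact g @` K).
pose W2 := \bigcup_(g in [set g : G | ~ H g.1]) (gact g @` K).
have closedW (P : set G) : closed (\bigcup_(g in P) (gact g @` K)).
  apply: subcomplex_closed; apply: subcomplex_bigcup => g _.
  exact: subcomplex_act fK.1.
set C := p @` `[0, 1] in pY.
have CW12 : C `&` W1 = C `&` ~` W2.
  apply/seteqP; split=> y [Cy].
    move=> [g Hg [u Ku guy]]; split=> // -[g' Hg' [u' Ku' gu'y]].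
    apply: Hg'; apply: (meet g g' u u') => //; first by rewrite guy.
    by rewrite guy; have [/largest_subcomplex_sub] := pY y Cy.
  move=> nW2; split=> //; have [_ /LW[g Wgy]] := pY y Cy.
  have gy : (gact g^-1%g @` K) y by exists (gact g y); [right|rewrite gactK].
  have [Hg|nHg] := pselect (H (g^-1)%g.1); first by exists g^-1%g.
  by case: nW2; exists g^-1%g.
have CW1 : C `&` W1 = C.
  have := connected_continuous_connected (@segment_connected R 0 1) pc; apply.
  - exists y0; split; first by exists 0; rewrite /= ?in_itv /= ?lexx ?ler01 // p0 gact1.
    by exists 1%g => //; exists y0 => //; rewrite gact1.
  - by exists (~` W2); [apply: closed_openC; exact: closedW|].
  - by exists W1; [exact: closedW|].
have Cb : C (gact (sd_inl phi b) y0) by exists 1; rewrite //= in_itv /= ler01 lexx.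
have [_ [g Hg [u Ku gu]]] : (C `&` W1) (gact (sd_inl phi b) y0) by rewrite CW1.
apply: (meet g (sd_inl phi b) u y0) => //.
by rewrite gu; have [/largest_subcomplex_sub] := pY _ Cb.
Qed.
End Control.

Theorem theorem2 (R : realType) (A : groupType) (n : nat) (x : 'I_n -> A)
  (x_basis : free_basis x) (B : groupType) (phi : aut_hom A B)
  (G_fg : finitely_generated (sdprod phi))
  (Y : gcw_complex R (sdprod phi)) (Y_nonempty : [set: Y] !=set0)
  (Y_free : free_action Y) (Y_contractible : contractible Y)
  (h : Y -> cayley_tree R x) (h_control : control_map h)
  (tau : based_ray R x) :
  ((exists2 S : set B, finite_set S &
      forall k : int, 0 <= k -> generates_over phi S (horoball_vertices tau k)) ->
    Sigma1 h tau) /\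
  ((forall k : int, k <= 0 ->
      ~ finitely_generated_over phi (horoball_vertices tau k)) ->
    ~ Sigma1 h tau).
Proof.
have x_gen := free_basis_word_val x_basis.
split=> [[S Sfin Sgen]|not_fg cc].
  exact: controlled_connected_of_generates Sfin Sgen.
have [k k0 /(not_fg k k0)] :=
  generated_over_of_controlled_connected x_gen h_control Y_nonempty Y_free cc.
by [].
Qed.
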